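(* Let $m\ge n\ge 1$, let $A\in\mathbb{R}^{m\times m}$ be symmetric positive definite and let $Z\in\mathbb{R}^{m\times n}$ have full column rank. In exact arithmetic, the algorithm MGS-HA(col) applied to $Z$ and $A$ produces the same $Q$ and $R$ as the column-oriented modified Gram-Schmidt algorithm MGS(col) with the $A$-inner product (so that $Z=QR$ and $Q^{\rm T}AQ=I_n$), and its computational cost is $n$ matrix-vector multiplications with $A$ plus $2mn^2$ further floating-point operations (leading-order count).
   Context: For an spd matrix $A$, $(\boldsymbol x,\boldsymbol y)_A := \boldsymbol x^{\rm T}A\boldsymbol y$ and $\|\boldsymbol x\|_A:=\sqrt{\boldsymbol x^{\rm T}A\boldsymbol x}$. In both algorithms $Z=[\boldsymbol z_1^{(0)},\dots,\boldsymbol z_n^{(0)}]$, the output is $Q=[\boldsymbol q_1,\dots,\boldsymbol q_n]$ and the upper triangular $R=(r_{ij})$ with $r_{ij}=0$ for $i>j$. MGS(col): for $j=1,\dots,n$: for $i=1,\dots,j-1$ set $r_{ij}=(\boldsymbol q_i,\boldsymbol z_j^{(i-1)})_A$ and $\boldsymbol z_j^{(i)}=\boldsymbol z_j^{(i-1)}-r_{ij}\boldsymbol q_i$; then set $r_{jj}=\|\boldsymbol z_j^{(j-1)}\|_A$ and $\boldsymbol q_j=\boldsymbol z_j^{(j-1)}/r_{jj}$. MGS-HA(col): for $j=1,\dots,n$: for $i=1,\dots,j-1$ set $r_{ij}=\boldsymbol p_i^{\rm T}\boldsymbol z_j^{(i-1)}$ and $\boldsymbol z_j^{(i)}=\boldsymbol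 z_j^{(i-1)}-r_{ij}\boldsymbol q_i$; then set $\boldsymbol x_j^{(j-1)}=A\boldsymbol z_j^{(j-1)}$, $r_{jj}=\sqrt{(\boldsymbol z_j^{(j-1)})^{\rm T}\boldsymbol x_j^{(j-1)}}$, $\boldsymbol q_j=\boldsymbol z_j^{(j-1)}/r_{jj}$ and $\boldsymbol p_j=\boldsymbol x_j^{(j-1)}/r_{jj}$. Floating-point operations are scalar additions, subtractions, multiplications, divisions and square roots. ''$2mn^2$ (leading-order count)'' means that only the leading term is kept: terms of order $O(mn+n^2)$ are dropped. *)

(* Defs.v *)
From HB Require Import structures.
From mathcomp Require Import all_boot all_order all_algebra.
From mathcomp Require Import reals.
Set Implicit Arguments.
Unset Strict Implicit.
Unset Printing Implicit Defensive.
Import Order.TTheory GRing.Theory Num.Theory.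
Local Open Scope ring_scope.

Section InnerProduct.
Variables (R : realType) (m : nat).
Implicit Types (A : 'M[R]_m) (x y : 'cV[R]_m).

Definition spd A : Prop :=
  A^T = A /\ forall x, x != 0 -> 0 < (x^T *m A *m x) 0 0.

Definition inner A x y : R := (x^T *m A *m y) 0 0.

Definition Anorm A x : R := Num.sqrt ((x^T *m A *m x) 0 0).

End InnerProduct.

Definition set_entry (R : Type) (m n : nat) (M : 'M[R]_(m, n))
    (i : 'I_m) (j : 'I_n) (a : R) : 'M[R]_(m, n) :=
  \matrix_(k, l) if (k == i) && (l == j) then a else M k l.

Definition set_col (R : Type) (m n : nat) (M : 'M[R]_(m, n))
    (j : 'I_n) (v : 'cV[R]_m) : 'M[R]_(m, n) :=
  \matrix_(k, l) if l == j then v k 0 else M k l.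

(* The range of the inner loop "for i = 1, ..., j - 1", in increasing order. *)
Definition before (n : nat) (j : 'I_n) : seq 'I_n :=
  [seq i : 'I_n <- enum 'I_n | (i < j)%N].

Section MGS.
Variables (R : realType) (m n : nat) (A : 'M[R]_m) (Z : 'M[R]_(m, n)).

(* State (z_j^(i-1), R) to (z_j^(i), R). *)
Definition mgs_inner (Q : 'M[R]_(m, n)) (j : 'I_n)
    (st : 'cV[R]_m * 'M[R]_n) (i : 'I_n) : 'cV[R]_m * 'M[R]_n :=
  let: (z, Rm) := st in
  let r := inner A (col i Q) z in
  (z - r *: col i Q, set_entry Rm i j r).

Definition mgs_outer (st : 'M[R]_(m, n) * 'M[R]_n) (j : 'I_n) :
    'M[R]_(m, n) * 'M[R]_n :=
  let: (Q, Rm) := st in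
  let: (z, Rm') := foldl (mgs_inner Q j) (col j Z, Rm) (before j) in
  let r := Anorm A z in
  (set_col Q j (r^-1 *: z), set_entry Rm' j j r).

(* R starts at 0 and only entries on or above the diagonal are written. *)
Definition mgs_col : 'M[R]_(m, n) * 'M[R]_n :=
  foldl mgs_outer (0, 0) (enum 'I_n).

End MGS.

(* Result of a computation in exact arithmetic, with the number of products by
   the matrix A and the number of scalar operations executed to obtain it. *)
Record counted (T : Type) :=
  Counted { value : T; matvecs : nat; flops : nat }.

Definition ret (T : Type) (x : T) : counted T := Counted x 0 0.

Definition bind (S T : Type) (c : counted S) (f : S -> counted T) : counted T :=
  let d := f (value c) in
  Counted (value d) (matvecs c + matvecs d) (flops c + flops d).

Notation "x <- c ;; d" := (bind c (fun x => d))
  (at level 100, c at next level, right associativity).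
Notation "' p <- c ;; d" := (bind c (fun p => d))
  (at level 100, p pattern, c at next level, right associativity).

Fixpoint for_each (I S : Type) (s : seq I) (body : S -> I -> counted S)
    (st : S) : counted S :=
  if s is i :: s' then st' <- body st i ;; for_each s' body st' else ret st.

Section CountedOperations.
Variables (R : realType) (m : nat).

Definition add_op (a b : R) : counted R := Counted (a + b) 0 1.
Definition sub_op (a b : R) : counted R := Counted (a - b) 0 1.
Definition mul_op (a b : R) : counted R := Counted (a * b) 0 1.
Definition div_op (a b : R) : counted R := Counted (a / b) 0 1.
Definition sqrt_op (a : R) : counted R := Counted (Num.sqrt a) 0 1.

(* The scalar operations inside a product by A are not counted as flops. *)
Definition matvec_op (A : 'M[R]_m) (x : 'cV[R]_m) : counted 'cV[R]_m :=
  Counted (A *m x) 1 0.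

Definition build_vec (f : 'I_m -> counted R) : counted 'cV[R]_m :=
  Counted (\col_k value (f k)) (\sum_k matvecs (f k))%N (\sum_k flops (f k))%N.

(* The accumulation starts from 0, hence 2m flops rather than 2m - 1. *)
Definition dot_op (x y : 'cV[R]_m) : counted R :=
  for_each (enum 'I_m)
    (fun s k => t <- mul_op (x k 0) (y k 0) ;; add_op s t) 0.

Definition axpy_op (z : 'cV[R]_m) (r : R) (q : 'cV[R]_m) : counted 'cV[R]_m :=
  build_vec (fun k => t <- mul_op r (q k 0) ;; sub_op (z k 0) t).

Definition divvec_op (x : 'cV[R]_m) (r : R) : counted 'cV[R]_m :=
  build_vec (fun k => div_op (x k 0) r).

End CountedOperations.

Section MGSHA.
Variables (R : realType) (m n : nat) (A : 'M[R]_m) (Z : 'M[R]_(m, n)).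

Definition ha_inner (Q P : 'M[R]_(m, n)) (j : 'I_n)
    (st : 'cV[R]_m * 'M[R]_n) (i : 'I_n) : counted ('cV[R]_m * 'M[R]_n) :=
  let: (z, Rm) := st in
  r <- dot_op (col i P) z ;;
  z' <- axpy_op z r (col i Q) ;;
  ret (z', set_entry Rm i j r).

Definition ha_outer (st : 'M[R]_(m, n) * 'M[R]_n * 'M[R]_(m, n)) (j : 'I_n) :
    counted ('M[R]_(m, n) * 'M[R]_n * 'M[R]_(m, n)) :=
  let: (Q, Rm, P) := st in
  '(z, Rm') <- for_each (before j) (ha_inner Q P j) (col j Z, Rm) ;;
  x <- matvec_op A z ;;
  s <- dot_op z x ;;
  r <- sqrt_op s ;;
  q <- divvec_op z r ;;
  p <- divvec_op x r ;;
  ret (set_col Q j q, set_entry Rm' j j r, set_col P j p).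

Definition mgs_ha_col : counted ('M[R]_(m, n) * 'M[R]_n) :=
  '(Q, Rm, _) <- for_each (enum 'I_n) ha_outer (0, 0, 0) ;; ret (Q, Rm).

End MGSHA.

(* Main.v *)
(** The vector [p_i] of MGS-HA(col) is always [A q_i], so symmetry of [A] turns
    each [p_i^T z] into [(q_i, z)_A] and both algorithms go through the same
    states. The columns of [Q] built so far are combinations of the
    columns of [Z] already read, so full column rank keeps every [z_j^(j-1)]
    nonzero and the normalisation meaningful. One inner step costs [4 m] flops
    and one outer step [4 m + 1] more: in total [2 m n^2 + 2 m n + n]. *)
Require Import Defs.
From HB Require Import structures.
From mathcomp Require Import all_boot all_order all_algebra.
From mathcomp Require Import reals.
From mathcomp Require Import zify.
Set Implicit Arguments.
Unset Strict Implicit.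
Unset Printing Implicit Defensive.
Import Order.TTheory GRing.Theory Num.Theory.
Local Open Scope ring_scope.

(** * Values and costs of loops *)

Section ForEach.
Variables (I S : Type) (body : S -> I -> counted S).

Lemma value_for_each (s : seq I) (st : S) :
  value (for_each s body st) = foldl (fun st i => value (body st i)) st s.
Proof. by elim: s st => //= i s IHs st; rewrite IHs. Qed.

(** The cost [c i] may depend on the index but not on the state, so a loop can be counted without
    knowing the values it computes. *)
Lemma matvecs_for_each (c : I -> nat) (s : seq I) (st : S) :
  (forall st i, matvecs (body st i) = c i) ->
  matvecs (for_each s body st) = (\sum_(i <- s) c i)%N.
Proof.
move=> bodyE; elim: s st => [|i s IHs] st /=; first by rewrite big_nil.
by rewrite big_cons bodyE IHs.
Qed.

Lemma flops_for_each (c : I -> nat) (s : seq I) (st : S) :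
  (forall st i, flops (body st i) = c i) ->
  flops (for_each s body st) = (\sum_(i <- s) c i)%N.
Proof.
move=> bodyE; elim: s st => [|i s IHs] st /=; first by rewrite big_nil.
by rewrite big_cons bodyE IHs.
Qed.

End ForEach.

(** * Values and costs of the vector operations *)

Section CountedOperationsTheory.
Variables (R : realType) (m : nat).
Implicit Types (x y z q : 'cV[R]_m) (r : R).

Lemma value_dot_op x y : value (dot_op x y) = (x^T *m y) 0 0.
Proof.
rewrite /dot_op value_for_each /= mxE.
(* The accumulator is generalised from 0 to [a] so that the induction on the list goes through. *)
have foldlE (s : seq 'I_m) a :
    foldl (fun b k => b + x k 0 * y k 0) a s = a + \sum_(k <- s) x k 0 * y k 0.
  elim: s a => [|k s IHs] a /=; first by rewrite big_nil addr0.
  by rewrite IHs big_cons addrA.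
rewrite foldlE add0r big_enum /=.
by apply: eq_bigr => k _; rewrite mxE.
Qed.

Lemma matvecs_dot_op x y : matvecs (dot_op x y) = 0%N.
Proof. by rewrite (matvecs_for_each (c := fun=> 0%N)) // big1. Qed.

Lemma flops_dot_op x y : flops (dot_op x y) = (2 * m)%N.
Proof.
rewrite (flops_for_each (c := fun=> 2%N)) // big_enum /=.
by rewrite sum_nat_const card_ord mulnC.
Qed.

Lemma value_axpy_op z r q : value (axpy_op z r q) = z - r *: q.
Proof. by apply/colP => k; rewrite !mxE. Qed.

Lemma matvecs_axpy_op z r q : matvecs (axpy_op z r q) = 0%N.
Proof. by rewrite /= big1. Qed.

Lemma flops_axpy_op z r q : flops (axpy_op z r q) = (2 * m)%N.
Proof. by rewrite /= sum_nat_const card_ord mulnC. Qed.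

Lemma value_divvec_op x r : value (divvec_op x r) = r^-1 *: x.
Proof. by apply/colP => k; rewrite !mxE mulrC. Qed.

Lemma matvecs_divvec_op x r : matvecs (divvec_op x r) = 0%N.
Proof. by rewrite /= big1. Qed.

Lemma flops_divvec_op x r : flops (divvec_op x r) = m.
Proof. by rewrite /= sum_nat_const card_ord muln1. Qed.

End CountedOperationsTheory.

(** * Operation count of MGS-HA(col) *)

Definition costE := (matvecs_dot_op, flops_dot_op, matvecs_axpy_op,
  flops_axpy_op, matvecs_divvec_op, flops_divvec_op).

(** Ordinals are numbered from 0, so [j] has exactly [j] predecessors. *)
Lemma sum_before (n : nat) (j : 'I_n) (c : nat) :
  (\sum_(i <- before j) c = j * c)%N.
Proof.
rewrite big_filter big_enum_cond /=.
rewrite -(big_ord_widen n (fun=> c)) ?(ltnW (ltn_ord j)) //.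
by rewrite sum_nat_const card_ord.
Qed.

Section Cost.
Variables (R : realType) (m n : nat) (A : 'M[R]_m) (Z : 'M[R]_(m, n)).

Lemma matvecs_ha_inner (Q P : 'M[R]_(m, n)) j st i :
  matvecs (ha_inner Q P j st i) = 0%N.
Proof.
by case: st => z Rm; rewrite /ha_inner; cbn [bind matvecs ret]; rewrite !costE.
Qed.

Lemma flops_ha_inner (Q P : 'M[R]_(m, n)) j st i :
  flops (ha_inner Q P j st i) = (4 * m)%N.
Proof.
case: st => z Rm; rewrite /ha_inner; cbn [bind flops ret]; rewrite !costE; lia.
Qed.

Lemma matvecs_ha_outer st j : matvecs (ha_outer A Z st j) = 1%N.
Proof.
case: st => [[Q Rm] P]; rewrite /ha_outer; cbn [bind matvecs].
rewrite (matvecs_for_each (c := fun=> 0%N)); last exact: matvecs_ha_inner.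
case: (value _) => z Rm'; cbn [bind matvecs ret matvec_op sqrt_op].
by rewrite !costE sum_before muln0.
Qed.

(** The [4 * m + 1] flops outside the inner loop are [2 * m] for the dot product, 1 for the square
    root and [m] for each of the two divisions. *)
Lemma flops_ha_outer st j :
  flops (ha_outer A Z st j) = (j * (4 * m) + (4 * m + 1))%N.
Proof.
case: st => [[Q Rm] P]; rewrite /ha_outer; cbn [bind flops].
rewrite (flops_for_each (c := fun=> (4 * m)%N)); last exact: flops_ha_inner.
case: (value _) => z Rm'; cbn [bind flops ret matvec_op sqrt_op].
rewrite !costE sum_before; lia.
Qed.

Lemma matvecs_mgs_ha_col : matvecs (mgs_ha_col A Z) = n.
Proof.
rewrite /mgs_ha_col; cbn [bind matvecs].
rewrite (matvecs_for_each (c := fun=> 1%N)); last exact: matvecs_ha_outer.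
case: (value _) => [[Q Rm] P] /=.
by rewrite addn0 big_enum /= sum1_card card_ord.
Qed.

(** The inner loops run [n (n - 1) / 2] times in all, which gives [2 m n^2 - 2 m n]; the rest of the
    outer steps adds [4 m n + n]. *)
Lemma flops_mgs_ha_col :
  flops (mgs_ha_col A Z) = (2 * m * n ^ 2 + 2 * m * n + n)%N.
Proof.
rewrite /mgs_ha_col; cbn [bind flops].
rewrite (flops_for_each (c := fun j : 'I_n => (j * (4 * m) + (4 * m + 1))%N));
  last exact: flops_ha_outer.
case: (value _) => [[Q Rm] P] /=.
rewrite addn0 big_enum /=.
elim: (n) => [|k IHk]; first by rewrite big_ord0 !muln0.
rewrite big_ord_recr /= IHk; nia.
Qed.

End Cost.

(** * The [A]-inner product and its norm *)

Section InnerTheory.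
Variables (R : realType) (m : nat) (A : 'M[R]_m).
Implicit Types (x y z : 'cV[R]_m) (a : R).

Lemma innerBr x y z : inner A x (y - z) = inner A x y - inner A x z.
Proof. by rewrite /inner mulmxBr !mxE. Qed.

Lemma innerZr x a y : inner A x (a *: y) = a * inner A x y.
Proof. by rewrite /inner -scalemxAr mxE. Qed.

(** A 1 by 1 matrix equals its transpose. *)
Lemma innerC x y : A^T = A -> inner A x y = inner A y x.
Proof.
move=> symA; rewrite /inner -[in RHS](trmxK (y^T *m A *m x)) [RHS]mxE.
by rewrite !trmx_mul symA trmxK mulmxA.
Qed.

Lemma innerZl x a y : A^T = A -> inner A (a *: x) y = a * inner A x y.
Proof. by move=> symA; rewrite innerC // innerZr innerC. Qed.

(** Positive definiteness keeps the argument of the square root nonnegative, away from the default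
    value of [Num.sqrt]. *)
Lemma inner_Anorm x : spd A -> inner A x x = Anorm A x ^+ 2.
Proof.
move=> [_ posA]; rewrite sqr_sqrtr //.
by have [->|/posA/ltW//] := eqVneq x 0; rewrite mulmx0 mxE.
Qed.

Lemma Anorm_neq0 x : spd A -> x != 0 -> Anorm A x != 0.
Proof. by move=> [_ posA] /posA x_gt0; rewrite gt_eqF // sqrtr_gt0. Qed.

Lemma gram_entry (n : nat) (Q : 'M[R]_(m, n)) i j :
  (Q^T *m A *m Q) i j = inner A (col i Q) (col j Q).
Proof.
rewrite /inner !mxE; apply: eq_bigr => k _.
rewrite !mxE; congr (_ * _); apply: eq_bigr => l _; by rewrite !mxE.
Qed.

End InnerTheory.

(** * Columns of products and of updated matrices *)

Lemma col_mulmx (R : pzSemiRingType) (m n p : nat) (A : 'M[R]_(m, n))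
    (B : 'M[R]_(n, p)) j :
  col j (A *m B) = A *m col j B.
Proof. by apply/colP => i; rewrite !mxE; apply: eq_bigr => k _; rewrite mxE. Qed.

Lemma mulmx_set_col (R : pzSemiRingType) (m n p : nat) (B : 'M[R]_(p, m))
    (M : 'M[R]_(m, n)) j v :
  B *m set_col M j v = set_col (B *m M) j (B *m v).
Proof.
apply/matrixP => k l; rewrite !mxE.
by case: eqVneq => [->|/negPf lj]; apply: eq_bigr => i _;
  rewrite mxE ?eqxx ?lj.
Qed.

Section Updates.
Variables (R : comRingType) (m n : nat).
Implicit Types (M : 'M[R]_(m, n)) (v : 'cV[R]_m) (w : 'cV[R]_n).

Lemma col_set_col M j v : col j (set_col M j v) = v.
Proof. by apply/colP => k; rewrite !mxE eqxx. Qed.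

Lemma col_set_col_neq M j v l : l != j -> col l (set_col M j v) = col l M.
Proof. by move=> /negPf lj; apply/colP => k; rewrite !mxE lj. Qed.

(** Overwriting a column is a rank-one update, which makes its effect on products linear algebra. *)
Lemma set_colE M j v : set_col M j v = M + (v - col j M) *m delta_mx 0 j.
Proof.
apply/matrixP => k l; rewrite !mxE big_ord1 !mxE eqxx /=.
by case: eqP => [->|_]; rewrite ?mulr1 ?mulr0 ?addr0 // addrC subrK.
Qed.

Lemma set_col_mulmx M j v w :
  set_col M j v *m w = M *m w + w j 0 *: (v - col j M).
Proof.
rewrite set_colE mulmxDl -mulmxA; congr (_ + _); apply/colP => k.
rewrite !mxE big_ord1 !mxE (bigD1 j) //= big1 => [|i /negPf ij].
  by rewrite !mxE !eqxx mul1r addr0 mulrC.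
by rewrite !mxE ij andbF mul0r.
Qed.

Lemma col_set_entry M i j a :
  col j (set_entry M i j a) = col j M + (a - M i j) *: delta_mx i 0.
Proof.
apply/colP => k; rewrite !mxE !eqxx !andbT.
by case: eqP => [->|_]; rewrite ?mulr1 ?mulr0 ?addr0 // addrC subrK.
Qed.

Lemma col_set_entry_neq M i j a l :
  l != j -> col l (set_entry M i j a) = col l M.
Proof. by move=> /negPf lj; apply/colP => k; rewrite !mxE lj andbF. Qed.

End Updates.

(** * Agreement of MGS-HA(col) with MGS(col) *)

Section Equivalence.
Variables (R : realType) (m n : nat) (A : 'M[R]_m) (Z : 'M[R]_(m, n)).
Hypothesis symA : A^T = A.

Lemma value_ha_inner (Q : 'M[R]_(m, n)) j st i :
  value (ha_inner Q (A *m Q) j st i) = mgs_inner A Q j st i.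
Proof.
case: st => z Rm; rewrite /ha_inner; cbn [bind value ret].
by rewrite value_axpy_op value_dot_op col_mulmx trmx_mul symA.
Qed.

(** The relation [P = A *m Q] survives the step because dividing by [r] commutes with multiplying by
    [A]. *)
Lemma value_ha_outer (Q : 'M[R]_(m, n)) Rm j :
  value (ha_outer A Z (Q, Rm, A *m Q) j) =
  let: (Q', Rm') := mgs_outer A Z (Q, Rm) j in (Q', Rm', A *m Q').
Proof.
rewrite /ha_outer /mgs_outer; cbn [bind value]; rewrite value_for_each.
rewrite (_ : foldl _ _ _ = foldl (mgs_inner A Q j) (col j Z, Rm) (before j));
  last by elim: (before j) (_, _) => //= i s IHs st; rewrite value_ha_inner.
case: (foldl _ _ _) => z Rm'; cbn [bind value ret matvec_op sqrt_op].
by rewrite !value_divvec_op value_dot_op mulmx_set_col -scalemxAr mulmxA.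
Qed.

Lemma value_mgs_ha_col : value (mgs_ha_col A Z) = mgs_col A Z.
Proof.
rewrite /mgs_ha_col /mgs_col; cbn [bind value]; rewrite value_for_each.
(* The initial [P = 0] is read as [A *m 0], so that [P = A *m Q] holds from the start. *)
rewrite -[X in (0, 0, X)](mulmx0 _ A).
suff -> (s : seq 'I_n) Q Rm :
    foldl (fun st j => value (ha_outer A Z st j)) (Q, Rm, A *m Q) s =
    let: (Q', Rm') := foldl (mgs_outer A Z) (Q, Rm) s in (Q', Rm', A *m Q').
  by case: foldl.
elim: s Q Rm => // j s IHs Q Rm; cbn [foldl]; rewrite value_ha_outer.
by case: mgs_outer => Q' Rm'; rewrite IHs.
Qed.

End Equivalence.

(** * Factorisation and orthonormality for MGS(col) *)

Section Correctness.
Variables (R : realType) (m n : nat) (A : 'M[R]_m) (Z : 'M[R]_(m, n)).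

(** A conservation law: each multiple of a column of [Q] taken from [z] is recorded in column [j] of
    [R]. The entries must start at zero because [set_entry] overwrites instead of adding. *)
Lemma mgs_inner_decomp (Q : 'M[R]_(m, n)) j z (Rm : 'M[R]_n) s :
    uniq s -> {in s, forall i, Rm i j = 0} ->
  let: (z', Rm') := foldl (mgs_inner A Q j) (z, Rm) s in
  z' + Q *m col j Rm' = z + Q *m col j Rm.
Proof.
elim: s z Rm => //= i s IHs z Rm /andP[i_notin_s s_uniq] Rm0.
set r := inner _ _ _; have Rij0 : Rm i j = 0 by rewrite Rm0 // mem_head.
have {}/IHs := s_uniq => /(_ (z - r *: col i Q) (set_entry Rm i j r)).
case: foldl => z' Rm' -> => [|l ls].
  rewrite col_set_entry Rij0 subr0 mulmxDr -scalemxAr -colE addrACA.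
  by rewrite addNr addr0.
rewrite mxE (negPf (memPn i_notin_s l ls)) /=.
by rewrite Rm0 // inE ls orbT.
Qed.

Lemma mgs_inner_frame (Q : 'M[R]_(m, n)) j z (Rm : 'M[R]_n) s k l :
    ~~ ((k \in s) && (l == j)) ->
  (foldl (mgs_inner A Q j) (z, Rm) s).2 k l = Rm k l.
Proof.
elim: s z Rm => //= i s IHs z Rm; rewrite inE negb_and negb_or => kl.
rewrite IHs ?mxE; last first.
  by case/orP: kl => [/andP[_ /negPf->]|/negPf->]; rewrite ?andbF.
by case/orP: kl => [/andP[/negPf->]|/negPf->]; rewrite ?andbF.
Qed.

(** Subtracting along [q_i] removes the component on [q_i], which has unit norm, and keeps the
    orthogonality to earlier columns already achieved; hence the induction from the end of the
    list. *)
Lemma mgs_inner_orthogonal (Q : 'M[R]_(m, n)) j z (Rm : 'M[R]_n) s :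
    uniq s ->
    {in s &, forall i l, inner A (col i Q) (col l Q) = (i == l)%:R} ->
  {in s, forall l,
    inner A (col l Q) (foldl (mgs_inner A Q j) (z, Rm) s).1 = 0}.
Proof.
elim/last_ind: s => // s i IHs; rewrite rcons_uniq => /andP[i_notin_s s_uniq].
move=> orthoQ l; rewrite foldl_rcons mem_rcons inE => l_in.
have sub x : x \in s -> x \in rcons s i by rewrite mem_rcons inE orbC => ->.
have i_in : i \in rcons s i by rewrite mem_rcons mem_head.
have {}IHs := IHs s_uniq (fun x y xs ys => orthoQ x y (sub x xs) (sub y ys)).
case: foldl IHs => z' Rm' /= IHs; rewrite innerBr innerZr.
case/predU1P: l_in => [->|ls].
  by rewrite orthoQ // eqxx mulr1 subrr.
rewrite IHs // (orthoQ l i (sub l ls) i_in).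
by rewrite (negPf (memPn i_notin_s l ls)) mulr0 subrr.
Qed.

Lemma mem_before (j i : 'I_n) : (i \in before j) = (i < j)%N.
Proof. by rewrite mem_filter mem_enum andbT. Qed.

Lemma before_uniq (j : 'I_n) : uniq (before j).
Proof. by rewrite filter_uniq // enum_uniq. Qed.

(* [T] records that the columns of [Q] lie in the span of the first [k]
   columns of [Z]; the columns of [Q] not yet written are still zero. *)
Definition mgs_invariant (k : nat) (st : 'M[R]_(m, n) * 'M[R]_n) : Prop :=
  [/\ forall i l : 'I_n, (i < k)%N -> (l < k)%N ->
        inner A (col i st.1) (col l st.1) = (i == l)%:R,
      forall l : 'I_n, (l < k)%N -> col l Z = st.1 *m col l st.2,
      forall i l : 'I_n, (k <= l)%N || (l < i)%N -> st.2 i l = 0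
    & exists2 T : 'M[R]_n, st.1 = Z *m T &
        forall i l : 'I_n, (k <= i)%N -> T i l = 0].

Hypothesis (spdA : spd A) (rankZ : \rank Z = n).

(** Full column rank of [Z] is full row rank of its transpose. *)
Lemma mulmx_full_col_rank (w : 'cV[R]_n) : Z *m w = 0 -> w = 0.
Proof.
move=> Zw0; have freeZ : row_free Z^T by rewrite /row_free mxrank_tr rankZ.
apply/trmx_inj/(row_free_inj freeZ).
by rewrite -trmx_mul Zw0 !trmx0 mul0mx.
Qed.

Lemma mgs_outer_invariant (j : 'I_n) st :
  mgs_invariant j st -> mgs_invariant j.+1 (mgs_outer A Z st j).
Proof.
have [symA _] := spdA.
case: st => Q Rm [/= orthoQ colZ Rm0 [T QT T0]].
have decomp := @mgs_inner_decomp Q j (col j Z) Rm _ (before_uniq j).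
have ortho := @mgs_inner_orthogonal Q j (col j Z) Rm _ (before_uniq j).
have frame := @mgs_inner_frame Q j (col j Z) Rm (before j).
rewrite /mgs_outer.
case: foldl decomp ortho frame => z Rm' /= decomp ortho frame.
have colRm0 : col j Rm = 0 by apply/colP => k; rewrite !mxE Rm0 // leqnn.
have {decomp}zE : z + Q *m col j Rm' = col j Z.
  by rewrite decomp ?colRm0 ?mulmx0 ?addr0 // => i _; rewrite Rm0 // leqnn.
have {}ortho (l : 'I_n) : (l < j)%N -> inner A (col l Q) z = 0.
  move=> lj; apply: ortho; rewrite ?mem_before // => i i'.
  by rewrite !mem_before; apply: orthoQ.
have {}frame (i l : 'I_n) : (l != j) || (j <= i)%N -> Rm' i l = Rm i l.
  by move=> h; apply: frame; rewrite mem_before negb_and -leqNgt orbC.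
have Rmjj : Rm' j j = 0 by rewrite frame ?leqnn ?orbT // Rm0 ?leqnn.
(* [w] holds coordinates of [z] in the columns of [Z]. Row [j] of [T] is zero, so [w j 0 = 1] and
   full column rank excludes [z = 0]. *)
pose w := delta_mx j 0 - T *m col j Rm'.
have zZw : z = Z *m w.
  by rewrite mulmxBr -colE mulmxA -QT -zE addrK.
have z_neq0 : z != 0.
  apply/eqP => z0; have /colP/(_ j) : w = 0.
    by apply: mulmx_full_col_rank; rewrite -zZw.
  rewrite !mxE !eqxx big1 => [|l _]; last by rewrite T0 ?leqnn ?mul0r.
  by rewrite subr0 => /eqP; rewrite oner_eq0.
set r := Anorm A z; have r_neq0 : r != 0 by apply: Anorm_neq0.
have split_lt (i : 'I_n) : (i < j.+1)%N -> (i == j) || (i < j)%N.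
  by rewrite ltnS leq_eqVlt.
have neq_lt (i : 'I_n) : (i < j)%N -> i != j.
  by move=> ij; rewrite -val_eqE neq_ltn ij.
have qz_norm : inner A (r^-1 *: z) (r^-1 *: z) = 1.
  rewrite innerZr innerZl // inner_Anorm // -/r expr2.
  by rewrite mulKf // mulVf.
split=> /=.
- move=> i l /split_lt/predU1P[->|ij] /split_lt/predU1P[->|lj].
  + by rewrite !col_set_col eqxx.
  + rewrite col_set_col (col_set_col_neq _ _ (neq_lt l lj)) innerC //.
    by rewrite innerZr ortho // mulr0 eq_sym (negPf (neq_lt l lj)).
  + rewrite col_set_col (col_set_col_neq _ _ (neq_lt i ij)).
    by rewrite innerZr ortho // mulr0 (negPf (neq_lt i ij)).
  + by rewrite !col_set_col_neq ?neq_lt // orthoQ.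
- move=> l /split_lt/predU1P[->|lj].
    (* The diagonal coefficient [r] brings in [z], and the terms in the old column [j] of [Q]
       cancel. *)
    rewrite col_set_entry Rmjj subr0 set_col_mulmx mulmxDr -scalemxAr -colE.
    rewrite -[LHS]zE !mxE Rmjj !eqxx mulr1 add0r scalerBr scalerA mulfV //.
    by rewrite scale1r addrACA subrr addr0 addrC.
  (* For [l < j] the entry of [R] at [(j, l)] is zero, so replacing column [j] of [Q] leaves the
     product unchanged. *)
  rewrite col_set_entry_neq ?neq_lt // set_col_mulmx.
  rewrite mxE frame ?neq_lt // Rm0 ?lj ?orbT // scale0r addr0 colZ //.
  by congr (_ *m _); apply/colP => i; rewrite !mxE frame ?neq_lt.
- move=> i l il; rewrite mxE.
  have -> : (i == j) && (l == j) = false.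
    by apply/negP => /andP[/eqP ij /eqP lj]; move: il; rewrite ij lj !ltnn.
  rewrite frame ?Rm0 //; first by case/orP: il => [/ltnW->|->]; rewrite ?orbT.
  case: eqVneq => //= lj; move: il; rewrite lj ltnn /=; exact: ltnW.
- exists (set_col T j (r^-1 *: w)).
    by rewrite mulmx_set_col -scalemxAr -QT -zZw.
  move=> i l ji; rewrite mxE; case: eqP => _; last by rewrite T0 // ltnW.
  have ij : i != j by rewrite -val_eqE neq_ltn ji orbT.
  rewrite !mxE (negPf ij) big1 ?subr0 ?mulr0 // => k _.
  by rewrite T0 ?mul0r // ltnW.
Qed.

Lemma mgs_col_invariant : mgs_invariant n (mgs_col A Z).
Proof.
(* The invariant is proved for every prefix of the outer loop; the empty prefix satisfies it with
   [T = 0]. *)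
suff take_inv k : (k <= n)%N ->
    mgs_invariant k (foldl (mgs_outer A Z) (0, 0) (take k (enum 'I_n))).
  by have := take_inv n (leqnn n); rewrite take_oversize // size_enum_ord.
elim: k => [|k IHk] lekn.
  rewrite take0 /=; split=> //= [i l _|]; first by rewrite mxE.
  by exists 0 => [|i l _]; rewrite ?mulmx0 ?mxE.
rewrite (take_nth (Ordinal lekn)) ?size_enum_ord // foldl_rcons.
rewrite (nth_ord_enum _ (Ordinal lekn)).
by apply: (@mgs_outer_invariant (Ordinal lekn)); apply/IHk/ltnW.
Qed.

Lemma mgs_col_factor : Z = (mgs_col A Z).1 *m (mgs_col A Z).2.
Proof.
have [_ colZ _ _] := mgs_col_invariant.
by apply/matrixP => i l; have /colP/(_ i) := colZ l (ltn_ord l);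
  rewrite -col_mulmx !mxE.
Qed.

Lemma mgs_col_orthonormal :
  (mgs_col A Z).1^T *m A *m (mgs_col A Z).1 = 1%:M.
Proof.
have [orthoQ _ _ _] := mgs_col_invariant.
by apply/matrixP => i l; rewrite gram_entry orthoQ // mxE.
Qed.

End Correctness.

Theorem mainTheorem3 :
  exists C : nat,
    forall (R : realType) (m n : nat) (A : 'M[R]_m) (Z : 'M[R]_(m, n)),
      (1 <= n)%N -> (n <= m)%N -> spd A -> \rank Z = n ->
      let run := mgs_ha_col A Z in
      let Q := (value run).1 in
      let Rm := (value run).2 in
      [/\ (Q, Rm) = mgs_col A Z,
          Z = Q *m Rm,
          Q^T *m A *m Q = 1%:M,
          matvecs run = n
        & `|(flops run)%:Z - (2 * m * n ^ 2)%N%:Z|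
            <= (C * (m * n + n ^ 2))%N%:Z].
Proof.
(* The excess over [2 m n^2] is [2 m n + n], at most [2 (m n + n^2)]. *)
exists 2%N => R m n A Z _ _ spdA rankZ run Q Rm.
have runE : value run = mgs_col A Z by apply: value_mgs_ha_col; case: spdA.
rewrite /Q /Rm runE; split.
- exact/esym/surjective_pairing.
- exact: mgs_col_factor.
- exact: mgs_col_orthonormal.
- exact: matvecs_mgs_ha_col.
rewrite /run flops_mgs_ha_col -addnA PoszD addrC addKr.
by rewrite ger0_norm // lez_nat; nia.
Qed.
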